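(* Let $k\ge3$ and $n$ be integers with $n>12k$. Then \[ C_{n,k}^{\rm loc}<0 . \] Hence the equal point is a saddle point of $S_{n,k}$. In particular, there are positive vectors $x$ arbitrarily close to the equal point for which $S_{n,k}(x)<\frac nk$.
   Context: Indices are modulo $n$. For $x_i>0$, $S_{n,k}(x)=\sum_{i=1}^n\frac{x_i}{x_{i+1}+\cdots+x_{i+k}}$, homogeneous of degree $0$. The equal point is $(1,\dots,1)$ (considered up to common scaling), where $S_{n,k}=n/k$. Define \[ C_{n,k}^{\rm loc}=\min_{1\le m\le n-1}\frac{|\lambda_{m,k}|^2-k\operatorname{Re}\lambda_{m,k}}{k^3},\qquad \lambda_{m,k}=\sum_{j=1}^k e^{2\pi\mathrm{i} mj/n}. \] ''Saddle'' means: the equal point is a critical point of $S_{n,k}$ and every neighbourhood of it contains positive vectors with $S_{n,k}<n/k$ and positive vectors with $S_{n,k}>n/k$. *)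

(* Defs.v *)
From HB Require Import structures.
From mathcomp Require Import all_boot all_order all_algebra.
From mathcomp Require Import all_classical all_reals all_analysis.
From mathcomp Require Import complex.

Set Implicit Arguments.
Unset Strict Implicit.
Unset Printing Implicit Defensive.

Import Order.TTheory GRing.Theory Num.Theory.
Import numFieldNormedType.Exports.

Local Open Scope classical_set_scope.
Local Open Scope ring_scope.

(* Vectors are 0-indexed: x_1, ..., x_n are x 0 0, ..., x 0 (n-1). Iterating the
   cyclic successor [ordS] j times gives the index i + j modulo n. *)
Definition cyclic_sum (R : realType) (n k : nat) (x : 'rV[R]_n) : R :=
  \sum_(i < n) x 0 i / \sum_(1 <= j < k.+1) x 0 (iter j (@ordS n) i).

(* e^{i t} for real t *)
Definition expi (R : realType) (t : R) : R[i] := Complex (cos t) (sin t).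

Definition lambda (R : realType) (n m k : nat) : R[i] :=
  \sum_(1 <= j < k.+1) expi (2 * pi * m%:R * j%:R / n%:R).

(* |lambda|^2 as an element of R: the norm of R[i] takes values in R[i]. *)
Definition local_term (R : realType) (n k m : nat) : R :=
  (complex.Re `|lambda R n m k| ^+ 2 - k%:R * complex.Re (lambda R n m k))
    / k%:R ^+ 3.

(* Minimum over 1 <= m <= n - 1. The default value of the iterated minimum is
   the term m = 1, which belongs to the range as soon as 2 <= n. *)
Definition Cloc (R : realType) (n k : nat) : R :=
  \big[Num.min/local_term R n k 1]_(1 <= m < n) local_term R n k m.

Definition equal_point (R : realType) (n : nat) : 'rV[R]_n := const_mx 1.

Definition positive_vec (R : realType) (n : nat) (x : 'rV[R]_n) : Prop :=
  forall i, 0 < x 0 i.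

Definition critical_point (R : realType) (n : nat) (f : 'rV[R]_n -> R)
    (p : 'rV[R]_n) : Prop :=
  differentiable f p /\ forall v, 'd f p v = 0.

Definition equal_point_saddle (R : realType) (n k : nat) : Prop :=
  critical_point (@cyclic_sum R n k) (equal_point R n) /\
  forall U : set 'rV[R]_n, nbhs (equal_point R n) U ->
    (exists x, [/\ U x, positive_vec x & cyclic_sum k x < n%:R / k%:R]) /\
    (exists y, [/\ U y, positive_vec y & n%:R / k%:R < cyclic_sum k y]).

(* Main.v *)
(* Along the line 1 + t v, with w_i = v_(i+1) + ... + v_(i+k), one has exactly
   S(1 + t v) = n / k + t^2 sum_i w_i (w_i - k v_i) / (k^2 (k + t w_i)).
   Hence the gradient at the equal point vanishes, and the sign of S - n/k near
   it is that of Q(v) = sum_i w_i (w_i - k v_i).  A unit vector has Q = k > 0.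
   For v the real and imaginary parts of the m-th Fourier mode the two values of
   Q add up to n (|lambda|^2 - k Re lambda), so a negative Fourier term gives a
   direction with Q < 0.  With b = pi m / n and k b = pi + a,
   sin^2 b (|lambda|^2 - k Re lambda) = sin a (sin a - k sin b cos (a + b)),
   which is negative for the smallest m > n / k, because a is then small. *)
Require Import Defs.
From mathcomp Require Import all_boot all_order all_algebra.
From mathcomp Require Import all_classical all_reals all_analysis.
From mathcomp Require Import complex ring lra zify.

Import Order.TTheory GRing.Theory Num.Theory.
Import numFieldNormedType.Exports.

Local Open Scope classical_set_scope.
Local Open Scope ring_scope.

(** * Jordan's inequality, closed forms of trigonometric sums, and the key sine estimate *)

Section Trigonometry.
Context {R : realType}.
Implicit Types (x a b : R) (k : nat).

(** Concavity: the mean slope [cos c] of sine on [0, x] is at least its mean slope [cos d] on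
    [x, pi / 2], since cosine decreases on [0, pi]. *)
Lemma jordan_sin_ge x : 0 <= x <= pi / 2 -> 2 * x <= pi * sin x.
Proof.
move=> /andP[x0 xpi].
have cont a b : {within `[a, b], continuous (@sin R)}.
  exact/continuous_subspaceT/continuous_sin.
have [c + sc] := MVT_segment x0 (fun y _ => is_derive_sin y) (cont _ _).
have [d + sd] := MVT_segment xpi (fun y _ => is_derive_sin y) (cont _ _).
rewrite !in_itv/= => /andP[xd dpi] /andP[c0 cx].
have cdc : cos d <= cos c.
  have pi0 := @pi_gt0 R.
  have cI : c \in `[0, pi] by rewrite in_itv/=; apply/andP; split; lra.
  have dI : d \in `[0, pi] by rewrite in_itv/=; apply/andP; split; lra.
  by rewrite leNgt ltr_cos// -leNgt; lra.
move: sc sd; rewrite sin0 sin_pihalf => sc sd.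
have : 0 <= (cos c - cos d) * (x * (pi / 2 - x)).
  by rewrite mulr_ge0 ?mulr_ge0// subr_ge0.
have -> : (cos c - cos d) * (x * (pi / 2 - x)) =
  cos c * (x - 0) * (pi / 2 - x) - x * (cos d * (pi / 2 - x)) by ring.
by rewrite -sc -sd; lra.
Qed.

(** Real part of the geometric sum of e^(2ijb), with its denominator sin b cleared: the result is
    sin(k b) e^(i(k+1)b). The next lemma is the imaginary part. *)
Lemma sin_mul_sum_cos b k :
  sin b * \sum_(1 <= j < k.+1) cos (2 * b * j%:R) =
  sin (k%:R * b) * cos (k.+1%:R * b).
Proof.
elim: k => [|k ih]; first by rewrite big_geq// mul0r sin0 mul0r mulr0.
rewrite big_nat_recr//= mulrDr {}ih.
set y := k.+1%:R * b.
have -> : k%:R * b = y - b by rewrite /y -natr1; ring.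
have -> : k.+2%:R * b = y + b by rewrite /y -natr1; ring.
have -> : 2 * b * k.+1%:R = y + y by rewrite /y; ring.
by rewrite sinB !cosD; ring.
Qed.

Lemma sin_mul_sum_sin b k :
  sin b * \sum_(1 <= j < k.+1) sin (2 * b * j%:R) =
  sin (k%:R * b) * sin (k.+1%:R * b).
Proof.
elim: k => [|k ih]; first by rewrite big_geq// mul0r sin0 mul0r mulr0.
rewrite big_nat_recr//= mulrDr {}ih.
set y := k.+1%:R * b.
have -> : k%:R * b = y - b by rewrite /y -natr1; ring.
have -> : k.+2%:R * b = y + b by rewrite /y -natr1; ring.
have -> : 2 * b * k.+1%:R = y + y by rewrite /y; ring.
by rewrite sinB !sinD; ring.
Qed.

(* Jordan's inequality gives [k sin b >= 2], and [a + b <= 4 pi / 9], so it is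
   enough that sin (pi / 12) < sin (pi / 9) <= 2 sin (pi / 18). *)
Lemma sin_lt_mul_sin_cos k a b : (3 <= k)%N -> 0 < a <= pi / 12 ->
  k%:R * b = pi + a -> sin a < k%:R * sin b * cos (a + b).
Proof.
move=> k3 /andP[a0 a12] kb.
have pi0 := @pi_gt0 R.
have {}k3 : 3 <= k%:R :> R by rewrite (ler_nat _ 3).
have b0 : 0 < b by nra.
have b36 : b <= 13 / 36 * pi by nra.
have sinb : 2 <= k%:R * sin b.
  have : 2 * b <= pi * sin b by apply: jordan_sin_ge; apply/andP; split; lra.
  (* Multiply by k and use k b > pi. *)
  move=> H; have : 2 * pi <= pi * (k%:R * sin b) by nra.
  by move=> ?; rewrite -(ler_pM2l pi0); lra.
set g := pi / 2 - (a + b).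
have -> : cos (a + b) = sin g.
  by rewrite /g -cosBpihalf -cosN; congr cos; ring.
have g18 : pi / 18 <= g by rewrite /g; lra.
have g2 : g < pi / 2 by rewrite /g; lra.
have mono (x y : R) : 0 <= x -> x < y -> y <= pi / 2 -> sin x < sin y.
  move=> *; rewrite ltr_sin ?in_itv//=; apply/andP; split; lra.
have sa : sin a < sin (pi / 18 + pi / 18) by apply: mono; lra.
have s9 : sin (pi / 18 + pi / 18) <= 2 * sin (pi / 18) :> R.
  rewrite sinD.
  have := cos_le1 (pi / 18 : R).
  have : 0 < sin (pi / 18 : R) by apply: sin_gt0_pihalf; apply/andP; split; lra.
  by move=> *; nra.
have s18 : sin (pi / 18) <= sin g.
  have [->//|ne] := eqVneq (pi / 18) g.
  by apply/ltW/mono; rewrite ?lt_neqAle ?ne//; lra.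
have sg0 : 0 < sin g by apply: sin_gt0_pihalf; apply/andP; split; lra.
nra.
Qed.

End Trigonometry.

(** * Exact expansion of the cyclic sum along lines through the equal point *)

Section Line.
Context {R : realType} {n : nat}.
Implicit Types (v x : 'rV[R]_n) (i : 'I_n) (t : R).

Definition window (k : nat) v i : R := \sum_(1 <= j < k.+1) v 0 (iter j (@ordS n) i).

Definition remainder (k : nat) v t : R :=
  \sum_(i < n) window k v i * (window k v i - k%:R * v 0 i)
     / (k%:R ^+ 2 * (k%:R + t * window k v i)).

Definition quadratic (k : nat) v : R :=
  \sum_(i < n) window k v i * (window k v i - k%:R * v 0 i).

Lemma iter_ordS_inj j : injective (iter j (@ordS n)).
Proof. by elim: j => [|j ih] x y //= /ordS_inj /ih. Qed.

Lemma val_iter_ordS j i : val (iter j (@ordS n) i) = ((i + j) %% n)%N.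
Proof.
elim: j => [|j ih] /=; first by rewrite addn0 modn_small.
by rewrite ih -addn1 modnDml addn1 addnS.
Qed.

(** Each cyclic shift permutes the indices, so each of the k offsets contributes the full sum. *)
Lemma sum_window k v : \sum_(i < n) window k v i = k%:R * \sum_(i < n) v 0 i.
Proof.
rewrite /window exchange_big /=.
rewrite (eq_bigr (fun=> \sum_(i < n) v 0 i)); last first.
  by move=> j _; rewrite [RHS](reindex_inj (@iter_ordS_inj j)).
by rewrite big_const_nat subSS subn0 iter_addr_0 mulr_natl.
Qed.

Lemma window_line k v t i :
  window k (t *: v + equal_point R n) i = k%:R + t * window k v i.
Proof.
rewrite /window mulr_sumr.
under eq_bigr do rewrite !mxE.
by rewrite big_split/= big_const_nat subSS subn0 iter_addr_0 addrC.
Qed.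

Lemma cyclic_sum_line k v t : (0 < k)%N ->
  (forall i, k%:R + t * window k v i != 0) ->
  cyclic_sum k (t *: v + equal_point R n) =
  n%:R / k%:R + t ^+ 2 * remainder k v t.
Proof.
move=> k0 nz; have k0' : k%:R != 0 :> R by rewrite pnatr_eq0 -lt0n.
(* The added first-order terms cancel in total by [sum_window]; with them the identity holds summand
   by summand. *)
have -> : n%:R / k%:R = \sum_(i < n) (k%:R^-1 + t / k%:R ^+ 2 * (k%:R * v 0 i - window k v i)).
  rewrite big_split/= -mulr_sumr sumrB -mulr_sumr sum_window subrr mulr0 addr0.
  by rewrite sumr_const card_ord -[RHS]mulr_natl.
rewrite /remainder mulr_sumr -big_split/=.
apply: eq_bigr => i _; rewrite -/(window _ _ _) window_line !mxE.
by field; rewrite nz k0'.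
Qed.

Lemma affine_cvg (a b : R) : a + t * b @[t --> (0 : R)] --> a.
Proof.
rewrite -[X in _ --> X]addr0 -[X in _ --> _ + X](mul0r b).
by apply: cvgD; [exact: cvg_cst | apply: cvgM; [exact: cvg_id | exact: cvg_cst]].
Qed.

Lemma remainder_cvg k v : (0 < k)%N ->
  remainder k v t @[t --> 0] --> quadratic k v / k%:R ^+ 3.
Proof.
move=> k0; have k0' : k%:R != 0 :> R by rewrite pnatr_eq0 -lt0n.
rewrite /quadratic mulr_suml; apply: cvg_big => [|i _].
  exact: add_continuous.
apply: cvgMl_tmp; rewrite (exprSr _ 2).
apply: cvgV; first by rewrite mulf_neq0// expf_neq0.
by apply: cvgMl_tmp; exact: affine_cvg.
Qed.

Lemma line_cvg v : t *: v + equal_point R n @[t --> (0:R)] --> equal_point R n.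
Proof.
have : t *: v + equal_point R n @[t --> (0 : R)] --> (0 : R) *: v + equal_point R n.
  by apply: cvgD; [apply: cvgZr_tmp; exact: cvg_id | exact: cvg_cst].
by rewrite scale0r add0r.
Qed.

Lemma near_line_neq0 k v : (0 < k)%N ->
  \forall t \near (0 : R), forall i, k%:R + t * window k v i != 0.
Proof.
move=> k0.
apply: (@filter_forall _ _ (fun i t => k%:R + t * window k v i != 0) (nbhs (0 : R))) => i.
by apply: cvgr_neq0 (affine_cvg _ _) _; rewrite pnatr_eq0 -lt0n.
Qed.

Lemma near_line_positive v :
  \forall t \near (0 : R), positive_vec (t *: v + equal_point R n).
Proof.
apply: (@filter_forall _ _ (fun i t => 0 < (t *: v + equal_point R n) 0 i) (nbhs (0 : R))) => i.
have /cvgr_gt/(_ 0 ltr01) := affine_cvg 1 (v 0 i).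
by apply: filterS => t; rewrite !mxE addrC.
Qed.

(** The line expansion controls only directional derivatives. Differentiability comes from each
    summand being a quotient of linear forms whose denominator is k at the equal point. *)
Lemma differentiable_cyclic_sum k : (0 < k)%N ->
  differentiable (@cyclic_sum R n k) (equal_point R n).
Proof.
move=> k0; have k0' : k%:R != 0 :> R by rewrite pnatr_eq0 -lt0n.
have -> : @cyclic_sum R n k = \sum_(i < n) (fun x => x 0 i * (window k x i)^-1).
  by apply/funext => x; rewrite fct_sumE.
apply: differentiable_sum => i; apply: differentiableM.
  exact: differentiable_coord.
apply: differentiableV.
  have -> : (window k)^~ i = \sum_(j < k) (fun x : 'rV[R]_n => x 0 (iter j.+1 (@ordS n) i)).
    by apply/funext => x; rewrite fct_sumE /window big_add1/= big_mkord.
  by apply: differentiable_sum => j; exact: differentiable_coord.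
rewrite -[equal_point R n]add0r -(scale0r (equal_point R n)) window_line.
by rewrite mul0r addr0.
Qed.

(** By the exact expansion, the difference quotient in direction v is t times the remainder, which
    tends to 0. *)
Lemma critical_equal_point k : (0 < k)%N ->
  critical_point (@cyclic_sum R n k) (equal_point R n).
Proof.
move=> k0; have df := differentiable_cyclic_sum k k0; split=> // v.
rewrite -deriveE// /derive; apply/cvg_lim => //.
have p0 : cyclic_sum k (equal_point R n) = n%:R / k%:R.
  have := cyclic_sum_line k 0 0 k0; rewrite scale0r add0r => ->.
    by rewrite expr0n mul0r addr0.
  by move=> i; rewrite mul0r addr0 pnatr_eq0 -lt0n.
have c0 : t * remainder k v t @[t --> 0^'] --> (0 : R).
  rewrite -[X in _ --> X](mul0r (quadratic k v / k%:R ^+ 3)).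
  apply: cvg_trans (cvgM _ (remainder_cvg k v k0)); last exact: cvg_id.
  by apply: cvg_app; exact: nbhs_dnbhs.
apply: cvg_trans c0; apply: near_eq_cvg; near=> t.
rewrite /= cyclic_sum_line//; last by near: t; exact/nbhs_dnbhs/near_line_neq0.
rewrite p0 addrAC subrr add0r expr2 -mulrA scalerA/=.
rewrite /GRing.scale/= mulrA mulVf ?mul1r//.
by near: t; exact: nbhs_dnbhs_neq.
Unshelve. all: by end_near.
Qed.

(** Near t = 0 the remainder has the sign of its limit; taking t in a punctured neighbourhood keeps
    t^2 positive. *)
Lemma near_lt_cyclic_sum k v : (0 < k)%N -> quadratic k v < 0 ->
  forall U : set 'rV[R]_n, nbhs (equal_point R n) U ->
  exists x, [/\ U x, positive_vec x & cyclic_sum k x < n%:R / k%:R].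
Proof.
move=> k0 q0 U nU.
have q3 : quadratic k v / k%:R ^+ 3 < 0.
  by rewrite pmulr_llt0// invr_gt0 exprn_gt0// ltr0n.
near (0 : R)^' => t; exists (t *: v + equal_point R n); split.
- by near: t; apply: nbhs_dnbhs; exact: line_cvg.
- by near: t; apply: nbhs_dnbhs; exact: near_line_positive.
- rewrite cyclic_sum_line//; last by near: t; exact/nbhs_dnbhs/near_line_neq0.
  rewrite gtrDl pmulr_rlt0; last first.
    by rewrite exprn_even_gt0//=; near: t; exact: nbhs_dnbhs_neq.
  by near: t; apply: nbhs_dnbhs; exact: cvgr_lt (remainder_cvg k v k0) _ q3.
Unshelve. all: by end_near.
Qed.

Lemma near_gt_cyclic_sum k v : (0 < k)%N -> 0 < quadratic k v ->
  forall U : set 'rV[R]_n, nbhs (equal_point R n) U ->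
  exists x, [/\ U x, positive_vec x & n%:R / k%:R < cyclic_sum k x].
Proof.
move=> k0 q0 U nU.
have q3 : 0 < quadratic k v / k%:R ^+ 3.
  by rewrite divr_gt0// exprn_gt0// ltr0n.
near (0 : R)^' => t; exists (t *: v + equal_point R n); split.
- by near: t; apply: nbhs_dnbhs; exact: line_cvg.
- by near: t; apply: nbhs_dnbhs; exact: near_line_positive.
- rewrite cyclic_sum_line//; last by near: t; exact/nbhs_dnbhs/near_line_neq0.
  rewrite ltrDl pmulr_rgt0; last first.
    by rewrite exprn_even_gt0//=; near: t; exact: nbhs_dnbhs_neq.
  by near: t; apply: nbhs_dnbhs; exact: cvgr_gt (remainder_cvg k v k0) _ q3.
Unshelve. all: by end_near.
Qed.

(* Since [k < n], the window of [i0] does not contain [i0], so [v_i w_i = 0]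
   for all [i] and only the squares [w_i ^ 2] remain. *)
Lemma quadratic_delta_gt0 k (i0 : 'I_n) : (0 < k < n)%N ->
  0 < quadratic k (delta_mx 0 i0).
Proof.
move=> /andP[k0 kn].
have w0 : window k (delta_mx 0 i0) i0 = 0.
  rewrite /window big_nat big1// => j /andP[j0 jk]; rewrite mxE eqxx/=.
  case: eqP => // /(congr1 val)/=; rewrite val_iter_ordS => /eqP.
  (* Returning to [i0] after j steps would force n to divide j, impossible for 1 <= j <= k < n. *)
  rewrite -{2}(modn_small (ltn_ord i0)) -{2}[val i0]addn0 eqn_modDl mod0n.
  by rewrite modn_small ?(leq_ltn_trans _ kn)// (gtn_eqF j0).
have E i : window k (delta_mx 0 i0) i *
    (window k (delta_mx 0 i0) i - k%:R * (delta_mx 0 i0 : 'rV[R]_n) 0 i) =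
    window k (delta_mx 0 i0) i ^+ 2.
  have [->|ne] := eqVneq i i0; first by rewrite w0 expr2 !mul0r.
  by rewrite [delta_mx _ _ _ _]mxE eqxx (negbTE ne)/= mulr0 subr0.
rewrite /quadratic (eq_bigr _ (fun i _ => E i)).
(* The window sums total k > 0, so they cannot all vanish and their sum of squares is positive. *)
have s : \sum_(i < n) window k (delta_mx 0 i0) i = k%:R.
  rewrite sum_window (bigD1 i0)//= big1 ?mxE ?eqxx ?addr0 ?mulr1// => i ne.
  by rewrite mxE (negbTE ne) andbF.
rewrite lt_neqAle sumr_ge0 ?andbT; last by move=> *; exact: sqr_ge0.
apply/eqP => /esym/eqP; rewrite psumr_eq0; last by move=> *; exact: sqr_ge0.
move=> /allP z; move: s; rewrite big1 => [/esym/eqP|i _].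
  by rewrite pnatr_eq0 -[_ == _]negbK -lt0n k0.
by apply/eqP; rewrite -(sqrf_eq0 (window _ _ _)); exact: z (mem_index_enum i).
Qed.

End Line.

(** * Fourier modes as test directions *)

Section Fourier.
Context {R : realType} {n : nat}.
Implicit Types (m k j : nat) (i : 'I_n).

(** For b = pi m / n these are the real and imaginary parts of [lambda]. *)
Definition cos_sum (b : R) k := \sum_(1 <= j < k.+1) cos (2 * b * j%:R).
Definition sin_sum (b : R) k := \sum_(1 <= j < k.+1) sin (2 * b * j%:R).

Definition fourier_num (b : R) k :=
  cos_sum b k ^+ 2 + sin_sum b k ^+ 2 - k%:R * cos_sum b k.

Definition half_angle m : R := pi * m%:R / n%:R.

Definition cos_vec m : 'rV[R]_n := \row_i cos (2 * half_angle m * i%:R).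
Definition sin_vec m : 'rV[R]_n := \row_i sin (2 * half_angle m * i%:R).

Lemma lambdaE m k :
  lambda R n m k = Complex (cos_sum (half_angle m) k) (sin_sum (half_angle m) k).
Proof.
rewrite /lambda /cos_sum /sin_sum.
apply: (big_rec3 (fun c s z => z = Complex c s)) => //= j c s z _ ->.
have -> : 2 * pi * m%:R * j%:R / n%:R = 2 * half_angle m * j%:R.
  by rewrite /half_angle; ring.
by [].
Qed.

Lemma local_termE m k :
  local_term R n k m = fourier_num (half_angle m) k / k%:R ^+ 3.
Proof.
by rewrite /local_term lambdaE normc_def/= sqr_sqrtr ?addr_ge0 ?sqr_ge0//.
Qed.

(** Reducing an index modulo n changes the angle by whole turns, so the modes respect cyclic
    indexing. *)
Lemma half_angle_modn m j : (0 < n)%N ->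
  2 * half_angle m * j%:R =
  2 * half_angle m * (j %% n)%:R + pi *+ 2 *+ (m * (j %/ n)).
Proof.
move=> n0; have n0' : n%:R != 0 :> R by rewrite pnatr_eq0 -lt0n.
rewrite {1}(divn_eq j n) /half_angle -[_ *+ (m * _)]mulr_natr -[pi *+ 2]mulr_natl.
by rewrite natrD !natrM; field.
Qed.

(** The Fourier mode is an eigenvector of the window operator with eigenvalue [lambda]; this is the
    real part of that relation, and the next lemma the imaginary part. *)
Lemma window_cos_vec m k i : window k (cos_vec m) i =
  cos_sum (half_angle m) k * cos_vec m 0 i -
  sin_sum (half_angle m) k * sin_vec m 0 i.
Proof.
rewrite /window !mulr_suml -sumrB; apply: eq_bigr => j _.
rewrite !mxE val_iter_ordS -(periodicn (@cosD2pi R) (m * ((i + j) %/ n))).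
rewrite -half_angle_modn ?(leq_ltn_trans _ (ltn_ord i))//.
by rewrite natrD mulrDr cosD; ring.
Qed.

Lemma window_sin_vec m k i : window k (sin_vec m) i =
  sin_sum (half_angle m) k * cos_vec m 0 i +
  cos_sum (half_angle m) k * sin_vec m 0 i.
Proof.
rewrite /window !mulr_suml -big_split/=; apply: eq_bigr => j _.
rewrite !mxE val_iter_ordS -(periodicn (@sinD2pi R) (m * ((i + j) %/ n))).
rewrite -half_angle_modn ?(leq_ltn_trans _ (ltn_ord i))//.
by rewrite natrD mulrDr sinD; ring.
Qed.

Lemma quadratic_cos_sin m k :
  quadratic k (cos_vec m) + quadratic k (sin_vec m) =
  n%:R * fourier_num (half_angle m) k.
Proof.
rewrite /quadratic -big_split/=.
rewrite (eq_bigr (fun=> fourier_num (half_angle m) k)); last first.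
  move=> i _; rewrite window_cos_vec window_sin_vec !mxE /fourier_num.
  set c := cos_sum _ _; set s := sin_sum _ _; set t := 2 * _ * _.
  (* The cross terms in cos t * sin t cancel between the two modes. *)
  transitivity ((c ^+ 2 + s ^+ 2 - k%:R * c) * (cos t ^+ 2 + sin t ^+ 2)).
    by ring.
  by rewrite cos2Dsin2 mulr1.
by rewrite sumr_const card_ord mulr_natl.
Qed.

End Fourier.

(** * Existence of a negative Fourier term *)

Lemma fourier_num_lt0 (R : realType) k (a b : R) : (3 <= k)%N ->
  0 < a <= pi / 12 -> k%:R * b = pi + a -> fourier_num b k < 0.
Proof.
move=> k3 a12 kb; have /andP[a0 a12'] := a12.
have pi0 := @pi_gt0 R.
have lt := sin_lt_mul_sin_cos _ _ _ k3 a12 kb.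
have sa : 0 < sin a by apply: sin_gt0_pi; apply/andP; split; lra.
(* Since k b = pi + a and (k + 1) b = pi + (a + b), the shift by pi flips each sign. *)
have skb : sin (k%:R * b) = - sin a by rewrite kb addrC sinDpi.
have ckb : cos (k.+1%:R * b) = - cos (a + b).
  by rewrite -natr1 mulrDl mul1r kb -cosDpi; congr cos; ring.
have sckb : sin (k.+1%:R * b) = - sin (a + b).
  by rewrite -natr1 mulrDl mul1r kb -sinDpi; congr sin; ring.
have C := sin_mul_sum_cos b k; have S := sin_mul_sum_sin b k.
rewrite -/(cos_sum _ _) -/(sin_sum _ _) ?skb ?ckb ?sckb in C S.
have E : sin b ^+ 2 * fourier_num b k =
    sin a * (sin a - k%:R * sin b * cos (a + b)).
  transitivity ((sin b * cos_sum b k) ^+ 2 + (sin b * sin_sum b k) ^+ 2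
      - k%:R * sin b * (sin b * cos_sum b k)).
    by rewrite /fourier_num; ring.
  rewrite C S.
  transitivity (sin a ^+ 2 * (cos (a + b) ^+ 2 + sin (a + b) ^+ 2)
      - k%:R * sin b * (sin a * cos (a + b))); first by ring.
  by rewrite cos2Dsin2; ring.
have : sin b ^+ 2 * fourier_num b k < 0 by rewrite E; nra.
(* Contraposition: as sin^2 b >= 0, a nonnegative [fourier_num] would make the product
   nonnegative. *)
rewrite ltNge => /negP h; rewrite ltNge; apply/negP => f0; apply: h.
by rewrite mulr_ge0 ?sqr_ge0.
Qed.

(* [m = n %/ k + 1] is the first frequency above [n / k]; the phase [k b] then
   exceeds [pi] by at most [pi k / n < pi / 12]. *)
Lemma exists_fourier_num_lt0 (R : realType) n k : (3 <= k)%N ->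
  (12 * k < n)%N ->
  exists2 m, (1 <= m < n)%N & fourier_num (@half_angle R n m) k < 0.
Proof.
move=> k3 kn; exists (n %/ k).+1; first by nia.
have n0 : 0 < n%:R :> R by rewrite ltr0n; lia.
set m := (n %/ k).+1.
have km : (n < k * m)%N by rewrite mulnC ltn_ceil//; lia.
have km' : (k * m <= n + k)%N by rewrite mulnS addnC leq_add2r mulnC leq_divM.
(* The witness for a is k b - pi with b = pi m / n. *)
apply: (@fourier_num_lt0 _ _ (pi * ((k * m)%:R - n%:R) / n%:R)) => //.
  have pi0 := @pi_gt0 R.
  rewrite -!(ltr_nat R) -!(ler_nat R) natrD in km km' kn.
  rewrite natrM in kn.
  rewrite divr_gt0 ?mulr_gt0 ?subr_gt0//= ler_pdivrMr//.
  have : (k * m)%:R - n%:R <= n%:R / 12 :> R by lra.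
  by nra.
by rewrite /half_angle natrM; field; rewrite gt_eqF.
Qed.

(** * From a negative Fourier term to the saddle property *)

Theorem theorem7p2 (R : realType) (n k : nat)
    (hk : (3 <= k)%N) (hn : (12 * k < n)%N) :
  [/\ Cloc R n k < 0,
      equal_point_saddle R n k
    & forall e : R, 0 < e ->
        exists x : 'rV[R]_n,
          [/\ positive_vec x, `|x - equal_point R n| < e
            & cyclic_sum k x < n%:R / k%:R]].
Proof.
have k0 : (0 < k)%N by lia.
have n0 : (0 < n)%N by lia.
have [m /andP[m1 mn] fm] := exists_fourier_num_lt0 R n k hk hn.
have [v qv] : exists v : 'rV[R]_n, quadratic k v < 0.
  have cs : n%:R * fourier_num (@half_angle R n m) k < 0.
    by rewrite pmulr_rlt0 ?ltr0n.
  rewrite -quadratic_cos_sin in cs.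
  (* The two values have a negative sum, so the cosine or the sine vector is a descent direction. *)
  have [c0|c0] := ltP (quadratic k (cos_vec m : 'rV[R]_n)) 0.
    by exists (cos_vec m).
  by exists (sin_vec m); lra.
have below := near_lt_cyclic_sum k v k0 qv.
split=> [||e e0].
- apply: (@le_lt_trans _ _ (local_term R n k m)).
    by apply: ge_bigmin_seq => //; rewrite mem_index_iota m1.
  by rewrite local_termE pmulr_llt0// invr_gt0 exprn_gt0// ltr0n.
- split; first exact: critical_equal_point.
  move=> U nU; split; first exact: below.
  have kn : (0 < k < n)%N by lia.
  exact: near_gt_cyclic_sum (quadratic_delta_gt0 k (Ordinal n0) kn) U nU.
- have [x [xe x0 xlt]] := below _ (nbhsx_ballx (equal_point R n) e e0).
  by exists x; split=> //; move: xe; rewrite -ball_normE/= distrC.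
Qed.
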